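(* Let $\{\mathbf{X}_1,\mathbf{X}_2,\dots,\mathbf{X}_K\}$ be a finite sequence of independent random Hermitian matrices in $\mathbb{C}^{d\times d}$. Then for any $\epsilon>0$, $$\mathbb{P}\Big\{\lambda_{\max}\Big(\sum_{k=1}^K\mathbf{X}_k\Big)\leq \epsilon\Big\}\leq \inf_{\theta>0}\Big\{e^{\theta\epsilon}\cdot \exp\Big(\lambda_{\max}\Big(\sum_{k=1}^K\log \mathbb{E}\,e^{-\theta\mathbf{X}_k}\Big)\Big)\Big\}.$$
   Context: For a Hermitian matrix $\mathbf{A}$, $\lambda_{\max}(\mathbf{A})$ denotes its largest eigenvalue. Functions of Hermitian matrices (matrix exponential and matrix logarithm) are defined by the spectral functional calculus: if $\mathbf{A}=\mathbf{U}\Lambda\mathbf{U}^*$ with $\mathbf{U}$ unitary and $\Lambda$ real diagonal, then $f(\mathbf{A})=\mathbf{U}f(\Lambda)\mathbf{U}^*$, with $f$ applied to the diagonal entries. The expectation of a random matrix is taken entrywise. *)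

(* Defs.v *)
From mathcomp Require Import all_boot all_order all_algebra.
From mathcomp Require Import complex.
From mathcomp Require Import all_classical all_reals all_analysis.

Set Implicit Arguments.
Unset Strict Implicit.
Unset Printing Implicit Defensive.

Import Order.TTheory GRing.Theory Num.Theory.
Import numFieldNormedType.Exports.

Local Open Scope classical_set_scope.
Local Open Scope ring_scope.
Local Open Scope complex_scope.

(** * Hermitian matrices and their functional calculus *)

Section hermitian_matrices.
Context {R : realType} {d : nat}.
Implicit Types (A U : 'M[R[i]]_d) (f : R -> R).

(* A = invmx (spectralmx A) *m diag_mx (spectral_diag A) *m spectralmx A for A
   normal, with spectralmx A unitary; the result does not depend on the
   diagonalization, see [mxfunE]. *)
Definition mxfun f A : 'M[R[i]]_d :=
  invmx (spectralmx A)
  *m diag_mx (map_mx (fun z => (f (complex.Re z))%:C) (spectral_diag A))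
  *m spectralmx A.

Definition mxexp A := mxfun expR A.

Definition mxlog A := mxfun (@ln R) A.

(* Eigenvalues of Hermitian matrices are real; when moreover 0 < d, this
   supremum is a maximum, see [lambda_max_eigenvalue]. *)
Definition lambda_max A : R := sup [set r : R | eigenvalue A r%:C].

Lemma mxfunE f A U (D : 'rV[R]_d) : U \is unitarymx ->
  A = U *m diag_mx (map_mx (fun r => r%:C) D) *m invmx U ->
  mxfun f A = U *m diag_mx (map_mx (fun r => (f r)%:C) D) *m invmx U.
Proof.
move=> Uu AE; have Uunit := unitarymx_unit Uu.
set DC := map_mx _ D in AE.
have DCE j : DC 0 j = (D 0 j)%:C by rewrite mxE.
have DCc : map_mx Num.conj DC = DC.
  by apply/matrixP => i j; rewrite mxE ord1 DCE; exact: conjc_real.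
have UV : invmx U = map_mx Num.conj U^T by rewrite invmx_unitary.
have Ah : A \is hermsymmx.
  apply/is_hermitianmxP; rewrite expr0 scale1r [in RHS]AE UV.
  rewrite !trmx_mul !map_mxM map_trmx trmxK -map_mx_comp.
  rewrite (map_mx_id (@conjCK _)) tr_diag_mx map_diag_mx [in LHS]AE UV mulmxA.
  by rewrite DCc.
have /orthomx_spectralP := hermitian_normalmx Ah.
rewrite /mxfun; have Su := spectral_unit A.
set S := spectralmx A in Su *; set L := spectral_diag A => ASE.
have WE : (S *m U) *m diag_mx DC = diag_mx L *m (S *m U).
  have : S *m A *m U = S *m A *m U by [].
  rewrite {1}AE [in RHS]ASE !mulmxA mulmxV// mul1mx.
  by rewrite -[in LHS](mulmxA _ (invmx U)) mulVmx// mulmx1.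
suff W2E : (S *m U) *m diag_mx (map_mx (fun r => (f r)%:C) D) =
    diag_mx (map_mx (fun z => (f (complex.Re z))%:C) L) *m (S *m U).
  apply: (can_inj (mulmxK Uunit)); apply: (can_inj (mulKmx Su)).
  rewrite -!mulmxA mulVmx// mulmx1 !mulmxA mulmxV// mul1mx.
  by rewrite W2E mulmxA.
apply/matrixP => i j; move/matrixP/(_ i j): WE.
rewrite !mul_mx_diag !mul_diag_mx [X in X = _]mxE [X in _ = X]mxE => WE.
rewrite [LHS]mxE [RHS]mxE ![map_mx _ _ _ _]mxE; move: WE; rewrite DCE.
set w := (S *m U) i j.
have [->|w0] := eqVneq w 0; first by rewrite !mul0r !mulr0.
by rewrite mulrC => /(mulIf w0) <-; rewrite mulrC.
Qed.

Lemma lambda_max_eigenvalue A : (0 < d)%N -> A \is hermsymmx ->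
  eigenvalue A (lambda_max A)%:C /\
  forall r : R, eigenvalue A r%:C -> r <= lambda_max A.
Proof.
move=> d0 Ah; set E := [set r : R | eigenvalue A r%:C].
pose L := spectral_diag A; pose S := spectralmx A.
have Su : S \in unitmx := spectral_unit A.
have LR j : (complex.Re (L 0 j))%:C = L 0 j.
  apply: RRe_real; exact: (mxOverP (hermitian_spectral_diag_real Ah)).
have /orthomx_spectralP := hermitian_normalmx Ah; rewrite -/L -/S => AE.
have SA : S *m A = diag_mx L *m S by rewrite AE !mulmxA mulmxV// mul1mx.
have EE r : E r <-> exists j, r = complex.Re (L 0 j).
  split=> [/eigenvalueP[v vA v0]|[j ->]].
    have : v *m invmx S != 0.
      apply: contra_neq v0 => /(congr1 (mulmx^~ S)).
      by rewrite mulmxKV// mul0mx.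
    case/rV0Pn=> j uj; exists j.
    have : v *m invmx S *m diag_mx L = r%:C *: (v *m invmx S).
      by rewrite scalemxAl -vA AE !mulmxA mulmxK.
    move/matrixP/(_ 0 j); rewrite mul_mx_diag [LHS]mxE [RHS]mxE mulrC.
    by move/(mulIf uj) => ->.
  apply/eigenvalueP; exists (row j S).
    by apply/rowP => k; rewrite LR -row_mul SA mxE mul_diag_mx !mxE.
  apply/negP => /eqP Sj; move: Su; rewrite -row_free_unit => /row_freeP[B SB].
  have := congr1 (row j) SB; rewrite row_mul Sj mul0mx => /matrixP/(_ 0 j).
  by rewrite !mxE eqxx => /esym/eqP; rewrite oner_eq0.
pose M := [arg max_(j > Ordinal d0) complex.Re (L 0 j)]%O.
have ME : E (complex.Re (L 0 M)) by apply/EE; exists M.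
have Mub : ubound E (complex.Re (L 0 M)).
  move=> r /EE[j ->]; rewrite /M.
  by case: Order.TotalTheory.arg_maxP => //= k _; exact.
have -> : lambda_max A = complex.Re (L 0 M).
  apply/eqP; rewrite eq_le; apply/andP; split.
    by apply: ge_sup => //; exists (complex.Re (L 0 M)).
  by apply: ub_le_sup => //; exists (complex.Re (L 0 M)).
by split=> // r; exact: Mub.
Qed.

End hermitian_matrices.

(** * Random matrices *)

Section random_matrices.
Context {R : realType} {dT} {T : measurableType dT}.
Variable P : probability T R.
Variable d : nat.
Implicit Types X : T -> 'M[R[i]]_d.

Definition random_mx X := forall i j,
  measurable_fun setT (fun w => complex.Re (X w i j)) /\
  measurable_fun setT (fun w => complex.Im (X w i j)).

Definition mx_integrable X := forall i j,
  P.-integrable setT (fun w => (complex.Re (X w i j))%:E) /\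
  P.-integrable setT (fun w => (complex.Im (X w i j))%:E).

Definition mx_expectation X : 'M[R[i]]_d :=
  \matrix_(i, j) (fine 'E_P[fun w => complex.Re (X w i j)]
                  +i* fine 'E_P[fun w => complex.Im (X w i j)]).

(* The Borel sigma-algebra of the real vector space of complex matrices,
   generated by its real coordinates. *)
Definition mx_measurable : set (set 'M[R[i]]_d) :=
  <<s [set A | exists (i j : 'I_d) (B : set R), measurable B /\
         (A = [set M : 'M[R[i]]_d | B (complex.Re (M i j))] \/
          A = [set M : 'M[R[i]]_d | B (complex.Im (M i j))])] >>.

Definition mx_independent (I : finType) (X : I -> T -> 'M[R[i]]_d) :=
  forall (J : {set I}) (B : I -> set 'M[R[i]]_d),
    (forall k, k \in J -> mx_measurable (B k)) ->
    P (\bigcap_(k in [set` J]) (X k @^-1` B k)) =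
    (\prod_(k in J) P (X k @^-1` B k))%E.

End random_matrices.

(* Main.v *)
Require Import Defs.
From HB Require Import structures.
From mathcomp Require Import all_boot all_order all_algebra.
From mathcomp Require Import complex.
From mathcomp Require Import all_classical all_reals all_analysis.
From mathcomp Require Import measurable_realfun.

(** Let [A_k = - theta X_k] and [M_k = E e^(A_k)].  The bound follows from an
    argument on the traces [tr A_k] and [tr (log M_k)] alone, which are scalars
    and add up over [k], even though the matrices need not commute.

    The largest eigenvalue of a Hermitian matrix dominates the mean [tr / d] of
    its eigenvalues ([Re_trace_le_lambda_max]).  So on the event of the theorem
    [tr (sum_k X_k) / d <= eps], and there
    [1 <= e^(theta eps) prod_k e^(tr A_k / d)].  The factors of this product are
    independent positive real random variables, so the probability of the event
    is at most [e^(theta eps) prod_k E e^(tr A_k / d)]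
    ([integral_prod_independent_le]).

    The heart of the proof is [integral_expR_trace_le]:
    [E e^(tr A / d) <= e^(tr (log M) / d)] with [M = E e^A].  Since
    [e^(tr A / d) = det (e^A)^(1/d)], this is the Jensen inequality for the
    function [det^(1/d)], concave on positive definite matrices by the
    determinant inequality of Minkowski.  It is proved with two scalar Jensen
    inequalities for [exp].  Write [q_v] for the quadratic form [mxquad v]; let
    [v_j] be an orthonormal eigenbasis of [M] with eigenvalues [m_j], and
    [q_j = q_(v_j)].  First, [e^(q_v A) <= q_v (e^A)] for every unit vector [v]
    ([expR_mxquad_le]), since [q_v A] is an average of the eigenvalues of [A].
    Then, averaging over [j],
    [e^((tr A - tr (log M)) / d) <= (1/d) sum_j e^(q_j A) / m_j
       <= (1/d) sum_j q_j (e^A) / m_j],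
    where the right-hand side is linear in [e^A] and has expectation
    [(1/d) sum_j m_j / m_j = 1].

    Multiplying over [k], the mean of the eigenvalues of [sum_k log M_k] appears
    in the exponent, and it is at most the largest eigenvalue.

    The event itself has to be shown measurable: for Hermitian [Y], whose
    characteristic polynomial has only real roots, [lambda_max Y <= e] holds
    exactly when all the coefficients of [char_poly Y] shifted by [e] are
    nonnegative ([lambda_max_le_coef]), and these coefficients are polynomials
    in the entries of [Y]. *)

Set Implicit Arguments.
Unset Strict Implicit.
Unset Printing Implicit Defensive.

Import Order.TTheory GRing.Theory Num.Theory.
Import numFieldNormedType.Exports.
Import HBNNSimple.

Local Open Scope classical_set_scope.
Local Open Scope ring_scope.
Local Open Scope complex_scope.
Local Open Scope sesquilinear_scope.

(** * Products of independent nonnegative random variables *)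

(** Indexing the values of a simple function by an ordinal makes
    [bigA_distr_bigA] applicable to products of such functions. *)
Lemma fimfun_ord_sum (U : Type) (R : realType) (f : {fimfun U >-> R}) :
  exists (n : nat) (y : 'I_n -> R), (forall j, exists x, f x = y j) /\
    forall x, f x = \sum_j y j * \1_(f @^-1` [set y j]) x.
Proof.
pose s := finmap.enum_fset (fset_set (range f)).
exists (size s), (fun j => nth 0 s j); split=> [j|x].
  have : nth 0 s j \in s by exact: mem_nth.
  by rewrite in_fset_set ?inE; [case=> x _ <-; exists x|exact: fimfunP].
rewrite [LHS]fimfunE fsbig_finite; last exact: fimfunP.
by rewrite (big_nth 0) big_mkord.
Qed.

Section product_of_independent.
Context {R : realType} {dT : measure_display} {T : measurableType dT}.
Variables (P : probability T R) (I : finType) (W : I -> T -> R).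
Hypothesis mW : forall k, measurable_fun setT (W k).
Hypothesis W_indep : forall B : I -> set R, (forall k, measurable (B k)) ->
  P (\bigcap_(k in [set: I]) (W k @^-1` B k)) = (\prod_k P (W k @^-1` B k))%E.

Lemma indic_bigcap (U : Type) (B : I -> set U) (x : U) :
  \1_(\bigcap_(k in [set: I]) B k) x = \prod_k \1_(B k) x :> R.
Proof.
rewrite indicE; have [xB|xB] := boolP (x \in _).
  rewrite big1// => k _; rewrite indicE mem_set//.
  by move: xB; rewrite inE => /(_ k); exact.
have [k kB] : exists k, ~ B k x.
  apply/existsNP => h; move/negP: xB; apply; rewrite inE => k _; exact: h.
by rewrite (bigD1 k)//= indicE memNset// mul0r.
Qed.

(** Expanding the product of the sums [g = sum_j y_j 1_(g = y_j)], both sides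
    are sums over the choices of one value [y_(f k)] for each [k], and
    independence equates them term by term. *)
Lemma integral_prod_simple (g : {nnsfun R >-> R}) :
  (\int[P]_w (\prod_k g (W k w))%:E = \prod_k \int[P]_w (g (W k w))%:E)%E.
Proof.
have [n [y [yg gE']]] := fimfun_ord_sum g.
pose B (j : 'I_n) : set R := g @^-1` [set y j].
have gE x : g x = \sum_j y j * \1_(B j) x by exact: gE'.
have mB j : measurable (B j) by exact: measurable_funPTI.
have mWB k j : measurable (W k @^-1` B j).
  by rewrite -[X in measurable X]setTI; exact: mW.
have y0 j : 0 <= y j by have [x <-] := yg j.
have intE k : (\int[P]_w (g (W k w))%:E =
    (\sum_j y j * fine (P (W k @^-1` B j)))%:E)%E.
  under eq_integral => w _ do rewrite gE -sumEFin.
  rewrite ge0_integral_sum//; first last.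
  - by move=> j w _; rewrite lee_fin mulr_ge0// indicE.
  - move=> j; apply/measurable_EFinP; apply: measurable_funM => //.
    by apply: measurableT_comp (mW k) => //; exact: measurable_indic.
  rewrite -sumEFin; apply: eq_bigr => j _.
  under eq_integral => w _ do rewrite EFinM.
  rewrite ge0_integralZl_EFin//; last first.
  - apply/measurable_EFinP.
    by apply: measurableT_comp (mW k) => //; exact: measurable_indic.
  have -> : (fun w => (\1_(B j) (W k w))%:E) =
      (fun w => (\1_(W k @^-1` B j) w)%:E :> \bar R) by [].
  by rewrite integral_indic// setIT EFinM fineK// fin_num_measure.
under [in RHS]eq_bigr => k _ do rewrite intE.
rewrite prodEFin bigA_distr_bigA/=.
under eq_integral => w _.
  under eq_bigr => k _ do rewrite gE.
  rewrite bigA_distr_bigA/= -sumEFin.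
  over.
have mC (f : {ffun I -> 'I_n}) :
    measurable (\bigcap_(k in [set: I]) (W k @^-1` B (f k))).
  by apply: fin_bigcap_measurable => // k _; exact: mWB.
rewrite /= ge0_integral_sum//; first last.
- move=> f w _; rewrite lee_fin; apply: prodr_ge0 => k _.
  by rewrite mulr_ge0// indicE.
- move=> f; apply/measurable_EFinP; apply: measurable_prod => k _.
  apply: measurable_funM => //.
  by apply: measurableT_comp (mW k) => //; exact: measurable_indic.
rewrite -sumEFin; apply: eq_bigr => f _.
under eq_integral => w _.
  rewrite big_split/=.
  have -> : \prod_k \1_(B (f k)) (W k w) =
    \1_(\bigcap_(k in [set: I]) (W k @^-1` B (f k))) w :> R.
    by rewrite indic_bigcap.
  rewrite EFinM.
  over.
rewrite ge0_integralZl_EFin//; last exact: prodr_ge0; last first.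
  by apply/measurable_EFinP; exact: measurable_indic.
rewrite integral_indic// setIT big_split/= EFinM; congr (_ * _)%E.
rewrite -prodEFin; transitivity (\prod_k P (W k @^-1` B (f k)))%E.
  exact: (W_indep (B := fun k => B (f k))).
by apply: eq_bigr => k _; rewrite fineK// fin_num_measure.
Qed.

(** One sequence of simple functions [g_n] increasing to the identity of the
    nonnegative reals serves for all the variables at once; monotone convergence
    passes from [g_n (W k)] to [W k].  Real upper bounds [c k] of the
    integrals keep the product on the right away from [0 * +oo]. *)
Lemma integral_prod_independent_le (c : I -> R) :
  (forall k w, 0 <= W k w) ->
  (forall k, (\int[P]_w (W k w)%:E <= (c k)%:E)%E) ->
  (\int[P]_w (\prod_k W k w)%:E <= (\prod_k c k)%:E)%E.
Proof.
move=> W0 Wc.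
have mf : measurable_fun setT (fun x : R => (Num.max x 0)%:E).
  by apply/measurable_EFinP; exact: measurable_maxr.
pose g := nnsfun_approx measurableT mf.
have g_nd x : {homo (fun n => g n x) : n m / (n <= m)%N >-> n <= m}.
  by move=> n m nm; have /lefP := nd_nnsfun_approx measurableT mf nm; exact.
have g_cvg x : 0 <= x -> g n x @[n --> \oo] --> x.
  move=> x0.
  have f0 (z : R) : setT z -> (0 <= (Num.max z 0)%:E)%E.
    by move=> _; rewrite lee_fin le_max lexx orbT.
  have := cvg_nnsfun_approx measurableT mf f0 (x := x) Logic.I.
  by rewrite max_l//; exact: fine_cvg.
have gW n k w : g n (W k w) <= W k w.
  have gnd : nondecreasing_seq (fun n => g n (W k w) : R).
    by move=> m p; exact: g_nd.
  have cg : (fun n => g n (W k w) : R) @ \oo --> W k w by exact: g_cvg.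
  have := nondecreasing_cvgn_le gnd (cvgP _ cg) n.
  by rewrite (cvg_lim (@Rhausdorff R) cg).
have mg n k : measurable_fun setT (fun w => g n (W k w)).
  exact: measurableT_comp (mW k).
pose h n w := (\prod_k g n (W k w))%:E.
have h_cvg w : h n w @[n --> \oo] --> (\prod_k W k w)%:E.
  apply: cvg_EFin; first by apply: nearW.
  rewrite /h/=; apply: cvg_big => [|k _]; last exact: g_cvg.
  exact: mul_continuous.
have -> : (\int[P]_w (\prod_k W k w)%:E = \int[P]_w limn (h^~ w))%E.
  by apply: eq_integral => w _; rewrite (cvg_lim _ (h_cvg w)).
have mh n : measurable_fun setT (h n).
  by apply/measurable_EFinP; apply: measurable_prod.
have h0 n w : setT w -> (0 <= h n w)%E by rewrite lee_fin prodr_ge0.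
have hnd w : setT w -> {homo h^~ w : n m / (n <= m)%N >-> (n <= m)%E}.
  move=> _ n m nm; rewrite lee_fin; apply: ler_prod => k _.
  by apply/andP; split => //; exact: g_nd.
have cvgh := cvg_monotone_convergence (mu := P) measurableT mh h0 hnd.
rewrite -(cvg_lim _ cvgh)//; apply: lime_le; first exact: cvgP cvgh.
apply: nearW => n; rewrite integral_prod_simple.
have int_le k : (\int[P]_w (g n (W k w))%:E <= (c k)%:E)%E.
  apply: le_trans (Wc k); apply: ge0_le_integral => //.
  - by move=> w _; rewrite lee_fin.
  - by apply/measurable_EFinP.
  - by apply/measurable_EFinP.
  - by move=> w _; rewrite lee_fin.
have int_fin k : (\int[P]_w (g n (W k w))%:E = (fine (\int[P]_w (g n (W k w))%:E))%:E)%E.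
  rewrite fineK// ge0_fin_numE; last by apply: integral_ge0 => w _; rewrite lee_fin.
  by apply: le_lt_trans (int_le k) _; rewrite ltry.
rewrite (eq_bigr (fun k => (fine (\int[P]_w (g n (W k w))%:E)%E)%:E)); last first.
  by move=> k _; exact: int_fin.
rewrite prodEFin lee_fin; apply: ler_prod => k _; apply/andP; split.
  by apply: fine_ge0; apply: integral_ge0 => w _; rewrite lee_fin.
by rewrite -lee_fin -int_fin.
Qed.

End product_of_independent.

(** * Jensen inequality for the exponential *)

(** The average of the tangent inequality [e^c (1 + (x - c)) <= e^x] at the
    barycenter [c], where the linear terms cancel. *)
Lemma expR_convex_sum (R : realType) (I : finType) (w x : I -> R) :
  (forall i, 0 <= w i) -> \sum_i w i = 1 ->
  expR (\sum_i w i * x i) <= \sum_i w i * expR (x i).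
Proof.
move=> w0 w1; set c := \sum_i w i * x i.
have -> : expR c = \sum_i w i * (expR c * (1 + (x i - c))).
  have -> : \sum_i w i * (expR c * (1 + (x i - c))) =
      expR c * (\sum_i w i + (\sum_i w i * x i - (\sum_i w i) * c)).
    rewrite mulr_suml -sumrB -big_split mulr_sumr; apply: eq_bigr => i _ /=.
    by rewrite mulrCA mulrDr mulrBr mulr1.
  by rewrite w1 mul1r subrr addr0 mulr1.
apply: ler_sum => i _; apply: ler_wpM2l => //.
rewrite -[X in _ <= expR X](subrKC c) expRD.
by apply: ler_wpM2l; [exact: expR_ge0|exact: expR_ge1Dx].
Qed.

(** * Real and imaginary parts *)

Section complex_parts.
Context {R : realType}.
Implicit Types z t : R[i].

Lemma ReD z t : complex.Re (z + t) = complex.Re z + complex.Re t.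
Proof. by case: z t => [a b] [x y]. Qed.

Lemma ReM z t : complex.Re (z * t) =
  complex.Re z * complex.Re t - complex.Im z * complex.Im t.
Proof. by case: z t => [a b] [x y]. Qed.

Lemma ImD z t : complex.Im (z + t) = complex.Im z + complex.Im t.
Proof. by case: z t => [a b] [x y]. Qed.

Lemma ImM z t : complex.Im (z * t) =
  complex.Re z * complex.Im t + complex.Im z * complex.Re t.
Proof. by case: z t => [a b] [x y]. Qed.

Lemma Re_sum (I : Type) (r : seq I) (F : I -> R[i]) :
  complex.Re (\sum_(i <- r) F i) = \sum_(i <- r) complex.Re (F i).
Proof. exact: (big_morph (@complex.Re R) ReD). Qed.

Lemma Re_scale (a : R) z : complex.Re (a%:C * z) = a * complex.Re z.
Proof. by rewrite ReM/= mul0r subr0. Qed.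

Lemma Re_mul_conj_ge0 z : 0 <= complex.Re (z * z^*).
Proof. by have := mulcJ_ge0 z; rewrite lecE => /andP[]. Qed.

End complex_parts.

(** * Quadratic forms, traces and eigenvalues of Hermitian matrices *)

Section spectral_calculus.
Context {R : realType} {d : nat}.
Implicit Types (A U : 'M[R[i]]_d) (f : R -> R) (v : 'rV[R[i]]_d).

Lemma hermsymmxE A : (A \is hermsymmx) = (A^t* == A).
Proof.
by apply/is_hermitianmxP/eqP; rewrite expr0 scale1r.
Qed.

Definition eigval A j : R := complex.Re (spectral_diag A 0 j).

Definition mxquad v A : R := complex.Re ((v *m A *m v^t*) 0 0).

Lemma spectralmx_invE A : invmx (spectralmx A) = (spectralmx A)^t*.
Proof. by rewrite invmx_unitary ?spectral_unitarymx. Qed.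

Lemma mxfun_id A : A \is hermsymmx -> mxfun id A = A.
Proof.
move=> Ah; have /orthomx_spectralP AE := hermitian_normalmx Ah.
rewrite /mxfun (_ : map_mx _ _ = spectral_diag A) -?AE//.
apply/rowP => j; rewrite mxE; apply: RRe_real.
exact: (mxOverP (hermitian_spectral_diag_real Ah)).
Qed.

Lemma mxfun_cst1 A : mxfun (fun=> 1) A = 1%:M.
Proof.
rewrite /mxfun (_ : diag_mx _ = 1%:M) ?mulmx1 ?mulVmx ?spectral_unit//.
by apply/matrixP => i j; rewrite !mxE.
Qed.

Lemma mxfun_hermsym f A : mxfun f A \is hermsymmx.
Proof.
rewrite hermsymmxE /mxfun spectralmx_invE !trmx_mul !map_mxM.
rewrite map_trmx trmxK -map_mx_comp (map_mx_id (@conjCK _)) tr_diag_mx.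
rewrite map_diag_mx mulmxA; set D := map_mx _ (spectral_diag A).
have -> // : map_mx Num.conj D = D.
by apply/rowP => j; rewrite !mxE; exact: conjc_real.
Qed.

Lemma hermsym_sum (I : finType) (F : I -> 'M[R[i]]_d) :
  (forall i, F i \is hermsymmx) -> \sum_i F i \is hermsymmx.
Proof.
move=> Fh; rewrite hermsymmxE raddf_sum raddf_sum/=; apply/eqP.
by apply: eq_bigr => i _; apply/eqP; rewrite -hermsymmxE.
Qed.

Lemma hermsym_scale (a : R) A : A \is hermsymmx -> a%:C *: A \is hermsymmx.
Proof.
rewrite !hermsymmxE => /eqP Ah; rewrite linearZ/= map_mxZ Ah.
by apply/eqP; congr (_ *: _); exact: conjc_real.
Qed.

(** For a unit vector [v] this is the spectral measure of [A] at [v]: a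
    probability on the indices of the eigenvalues. *)
Definition spectral_weight A v j : R :=
  let z := (v *m (spectralmx A)^t*) 0 j in complex.Re (z * z^*).

Lemma mxquad_mxfun v f A :
  mxquad v (mxfun f A) = \sum_j spectral_weight A v j * f (eigval A j).
Proof.
rewrite /mxquad /mxfun spectralmx_invE.
set S := spectralmx A; set D := map_mx _ (spectral_diag A).
have -> : v *m (S^t* *m diag_mx D *m S) *m v^t* =
    (v *m S^t*) *m diag_mx D *m (v *m S^t*)^t*.
  rewrite trmx_mul map_mxM map_trmx trmxK -map_mx_comp.
  by rewrite (map_mx_id (@conjCK _)) !mulmxA.
rewrite mxE Re_sum; apply: eq_bigr => j _.
rewrite mul_mx_diag /spectral_weight -/S !mxE -mulrA mulrC -mulrA Re_scale.
by rewrite [LHS]mulrC [X in complex.Re X]mulrC.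
Qed.

Lemma sum_spectral_weight A v :
  \sum_j spectral_weight A v j = mxquad v 1%:M.
Proof.
rewrite -(mxfun_cst1 A) mxquad_mxfun.
by apply: eq_bigr => j _; rewrite mulr1.
Qed.

(** Both quadratic forms are averages against the spectral weights, of the
    eigenvalues and of their exponentials, so this is the Jensen inequality. *)
Lemma expR_mxquad_le v A : A \is hermsymmx -> mxquad v 1%:M = 1 ->
  expR (mxquad v A) <= mxquad v (mxexp A).
Proof.
move=> Ah v1.
have -> : mxquad v A = mxquad v (mxfun id A) by rewrite mxfun_id.
rewrite [X in expR X]mxquad_mxfun [X in _ <= X]mxquad_mxfun.
apply: expR_convex_sum; last by rewrite sum_spectral_weight.
by move=> j; exact: Re_mul_conj_ge0.
Qed.

Lemma mxquad_row U j A :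
  mxquad (row j U) A = complex.Re ((U *m A *m U^t*) j j).
Proof.
rewrite /mxquad -row_mul [in LHS]mxE [in RHS]mxE; congr complex.Re.
by apply: eq_bigr => k _; rewrite !mxE.
Qed.

Lemma mxquad_row1 U j : U \is unitarymx -> mxquad (row j U) 1%:M = 1.
Proof. by move/unitarymxP => Uu; rewrite mxquad_row mulmx1 Uu mxE eqxx. Qed.

Lemma sum_mxquad_row U A : U \is unitarymx ->
  \sum_j mxquad (row j U) A = complex.Re (\tr A).
Proof.
move=> Uu; under eq_bigr => j _ do rewrite mxquad_row.
rewrite -Re_sum -/(mxtrace _) mxtrace_mulC mulmxA -invmx_unitary//.
by rewrite mulVmx ?mul1mx// unitarymx_unit.
Qed.

Lemma mxquad_spectral f A j :
  mxquad (row j (spectralmx A)) (mxfun f A) = f (eigval A j).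
Proof.
rewrite mxquad_row /mxfun -spectralmx_invE !mulmxA mulmxV ?spectral_unit//.
by rewrite mul1mx mulmxK ?spectral_unit// !mxE eqxx.
Qed.

Lemma Re_trace_mxfun f A :
  complex.Re (\tr (mxfun f A)) = \sum_j f (eigval A j).
Proof.
rewrite -(sum_mxquad_row _ (spectral_unitarymx A)).
by apply: eq_bigr => j _; rewrite mxquad_spectral.
Qed.

Lemma eigval_eigenvalue A j : A \is hermsymmx -> eigenvalue A (eigval A j)%:C.
Proof.
move=> Ah; set S := spectralmx A; have Su : S \in unitmx := spectral_unit A.
have SA : S *m A = diag_mx (map_mx (fun z => (complex.Re z)%:C) (spectral_diag A)) *m S.
  have -> : S *m A = S *m mxfun id A by rewrite mxfun_id.
  rewrite /mxfun -/S /=; clearbody S; move: (diag_mx _) => D.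
  by rewrite !mulmxA mulmxV// mul1mx.
apply/eigenvalueP; exists (row j S).
  by apply/rowP => k; rewrite -row_mul SA mxE mul_diag_mx !mxE.
apply/negP => /eqP Sj; move: (mxquad_row1 j (spectral_unitarymx A)).
by rewrite -/S Sj /mxquad !mul0mx mxE => /eqP; rewrite eq_sym oner_eq0.
Qed.

Lemma Re_trace_le_lambda_max A : (0 < d)%N -> A \is hermsymmx ->
  complex.Re (\tr A) <= d%:R * lambda_max A.
Proof.
move=> d0 Ah.
have -> : \tr A = \tr (mxfun id A) by rewrite mxfun_id.
rewrite Re_trace_mxfun.
rewrite mulr_natl -[X in _ *+ X]card_ord -sumr_const; apply: ler_sum => j _.
have [_ lmax] := lambda_max_eigenvalue d0 Ah.
by apply: lmax; exact: eigval_eigenvalue.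
Qed.

Lemma char_poly_hermsym A : A \is hermsymmx ->
  char_poly A = \prod_j ('X - (eigval A j)%:C%:P).
Proof.
move=> Ah; set S := spectralmx A; have Su : S \in unitmx := spectral_unit A.
pose D := diag_mx (map_mx (fun z => (complex.Re z)%:C) (spectral_diag A)).
have AE : A = invmx S *m D *m S by rewrite -[LHS](mxfun_id Ah).
pose SP := map_mx polyC S; pose SV := map_mx polyC (invmx S).
have SVS : SV *m SP = 1%:M by rewrite -map_mxM mulVmx// map_mx1.
have -> : char_poly A = char_poly D.
  rewrite /char_poly.
  have -> : char_poly_mx A = SV *m char_poly_mx D *m SP.
    rewrite /char_poly_mx mulmxBr mulmxBl -!map_mxM -AE.
    by rewrite scalar_mxC -mulmxA SVS mulmx1.
  by rewrite !det_mulmx mulrAC -det_mulmx SVS det1 mul1r.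
rewrite char_poly_trig; last exact: diag_mx_is_trig.
by apply: eq_bigr => j _; rewrite !mxE eqxx.
Qed.

(** The shifted polynomial is the product of the [X + (e - l_j)] over the
    eigenvalues [l_j].  If all [l_j <= e], it is a product of polynomials with
    nonnegative coefficients.  Conversely, a nonzero polynomial with nonnegative
    coefficients has no positive root, whereas [lambda_max A - e] is one.  This
    form of the condition involves only countably many polynomials in the
    entries of [A], hence its use for measurability. *)
Lemma lambda_max_le_coef A (e : R) : (0 < d)%N -> A \is hermsymmx ->
  lambda_max A <= e <->
  forall i, 0 <= (char_poly A \Po ('X + e%:C%:P))`_i.
Proof.
move=> d0 Ah; have [lE lmax] := lambda_max_eigenvalue d0 Ah.
split=> [le_e|coef0].
  rewrite char_poly_hermsym// rmorph_prod/=.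
  elim/big_ind: _ => [i|p q p0 q0 i|j _ i]; first by rewrite coef1 ler0n.
    by rewrite coefM; apply: sumr_ge0 => k _; rewrite mulr_ge0.
  rewrite comp_polyB comp_polyX comp_polyC -addrA -polyCB -rmorphB/=.
  rewrite coefD coefX coefC addr_ge0 ?ler0n//; case: ifP => // _.
  by rewrite ler0c subr_ge0 (le_trans _ le_e)//; apply: lmax; exact: eigval_eigenvalue.
rewrite leNgt; apply/negP => e_lt.
pose r := lambda_max A - e; have r0 : 0 < r%:C by rewrite ltcR subr_gt0.
set p := _ \Po _ in coef0.
have : p.[r%:C] = 0.
  rewrite horner_comp !hornerE/= -rmorphD/= subrK.
  by apply/eqP; rewrite -rootE -eigenvalue_root_char.
have size_p : size p = d.+1.
  by rewrite size_comp_poly2 ?size_XaddC// size_char_poly.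
have lead_p : 0 < p`_d.
  rewrite lt_def coef0 andbT; have : lead_coef p != 0.
    by rewrite lead_coef_eq0 -size_poly_eq0 size_p.
  by rewrite /lead_coef size_p.
move=> /eqP; rewrite horner_coef size_p big_ord_recr/= gt_eqF//.
apply: ltr_wpDl; last by rewrite mulr_gt0// exprn_gt0.
by apply: sumr_ge0 => i _; rewrite mulr_ge0// exprn_ge0// ltW.
Qed.

End spectral_calculus.

(** * Measurability of the largest eigenvalue *)

Section complex_measurability.
Context {R : realType} {dT : measure_display} {T : measurableType dT}.

Definition cmeasurable (f : T -> R[i]) :=
  measurable_fun setT (fun w => complex.Re (f w)) /\
  measurable_fun setT (fun w => complex.Im (f w)).

Lemma cmeasurable_cst z : cmeasurable (fun=> z).
Proof. by split; exact: measurable_cst. Qed.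

Lemma cmeasurableD f g :
  cmeasurable f -> cmeasurable g -> cmeasurable (fun w => f w + g w).
Proof.
move=> [f1 f2] [g1 g2]; split.
  by under eq_fun do rewrite ReD; exact: measurable_funD.
by under eq_fun do rewrite ImD; exact: measurable_funD.
Qed.

Lemma cmeasurableM f g :
  cmeasurable f -> cmeasurable g -> cmeasurable (fun w => f w * g w).
Proof.
move=> [f1 f2] [g1 g2]; split.
  by under eq_fun do rewrite ReM; apply: measurable_funB; exact: measurable_funM.
by under eq_fun do rewrite ImM; apply: measurable_funD; exact: measurable_funM.
Qed.

Lemma cmeasurable_sum (I : Type) (r : seq I) (F : I -> T -> R[i]) :
  (forall i, cmeasurable (F i)) -> cmeasurable (fun w => \sum_(i <- r) F i w).
Proof.
move=> mF; elim: r => [|i r IHr].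
  by under eq_fun do rewrite big_nil; exact: cmeasurable_cst.
by under eq_fun do rewrite big_cons; exact: cmeasurableD.
Qed.

Lemma cmeasurable_ge0 f : cmeasurable f -> measurable [set w | 0 <= f w].
Proof.
move=> [mRe mIm].
have -> : [set w | 0 <= f w] =
    ((fun w => complex.Im (f w)) @^-1` [set 0]) `&`
    ((fun w => complex.Re (f w)) @^-1` `[0, +oo[%classic).
  apply/seteqP; split=> w /=; rewrite lecE/= in_itv/= andbT.
    by move=> /andP[/eqP -> ->].
  by move=> [-> ->]; rewrite eqxx.
apply: measurableI; rewrite -[X in measurable X]setTI.
  by apply: mIm => //; exact: measurable_set1.
by apply: mRe => //; exact: measurable_itv.
Qed.

Lemma cmeasurable_coef_prod (I : Type) (r : seq I) (F : I -> T -> {poly R[i]}) :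
  (forall i k, cmeasurable (fun w => (F i w)`_k)) ->
  forall k, cmeasurable (fun w => (\prod_(i <- r) F i w)`_k).
Proof.
move=> mF; elim: r => [|i r IHr] k.
  by under eq_fun do rewrite big_nil; exact: cmeasurable_cst.
under eq_fun do rewrite big_cons coefM.
by apply: cmeasurable_sum => j; exact: cmeasurableM.
Qed.

Lemma cmeasurable_coef_char_poly d (Y : T -> 'M[R[i]]_d) :
  (forall i j, cmeasurable (fun w => Y w i j)) ->
  forall k, cmeasurable (fun w => (char_poly (Y w))`_k).
Proof.
move=> mY k; rewrite /char_poly /determinant.
under eq_fun do rewrite coef_sum.
apply: cmeasurable_sum => s.
under eq_fun do rewrite -(rmorph_sign polyC) coefCM.
apply: cmeasurableM; first exact: cmeasurable_cst.
apply: cmeasurable_coef_prod => i j.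
under eq_fun do rewrite !mxE coefB coefC.
apply: cmeasurableD; first exact: cmeasurable_cst.
under eq_fun do rewrite -mulN1r.
apply: cmeasurableM; first exact: cmeasurable_cst.
by case: (j == 0); [exact: mY|exact: cmeasurable_cst].
Qed.

Lemma measurable_lambda_max_le d (Y : T -> 'M[R[i]]_d) (e : R) : (0 < d)%N ->
  (forall i j, cmeasurable (fun w => Y w i j)) ->
  (forall w, Y w \is hermsymmx) ->
  measurable [set w | lambda_max (Y w) <= e].
Proof.
move=> d0 mY Yh.
have -> : [set w | lambda_max (Y w) <= e] =
    \bigcap_k [set w | 0 <= (char_poly (Y w) \Po ('X + e%:C%:P))`_k].
  apply/seteqP; split=> w /=.
    by move=> /(lambda_max_le_coef _ d0 (Yh w)) h k _; exact: h.
  by move=> h; apply/(lambda_max_le_coef _ d0 (Yh w)) => k; exact: h.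
apply: bigcapT_measurable => k; apply: cmeasurable_ge0.
under eq_fun do rewrite coef_comp_poly size_char_poly.
apply: cmeasurable_sum => i; apply: cmeasurableM; last exact: cmeasurable_cst.
exact: cmeasurable_coef_char_poly.
Qed.

End complex_measurability.

(** * Expectations of random Hermitian matrices *)

Section matrix_expectation.
Context {R : realType} {dT : measure_display} {T : measurableType dT}.
Variables (P : probability T R) (d : nat).
Implicit Types (B : T -> 'M[R[i]]_d) (v : 'rV[R[i]]_d).

Lemma integral_linear2 (a b : R) (f g : T -> R) :
  P.-integrable setT (EFin \o f) -> P.-integrable setT (EFin \o g) ->
  P.-integrable setT (fun w => (a * f w + b * g w)%:E) /\
  (\int[P]_w (a * f w + b * g w)%:E =
    (a * fine (\int[P]_w (f w)%:E) + b * fine (\int[P]_w (g w)%:E))%:E)%E.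
Proof.
move=> fi gi.
have afi : P.-integrable setT (fun w => a%:E * (f w)%:E)%E by exact: integrableZl.
have bgi : P.-integrable setT (fun w => b%:E * (g w)%:E)%E by exact: integrableZl.
under [X in P.-integrable _ X]eq_fun do rewrite EFinD !EFinM.
split; first exact: integrableD.
under eq_integral do rewrite EFinD !EFinM.
rewrite integralD// integralZl// integralZl//.
by rewrite EFinD !EFinM !fineK//; exact: integrable_fin_num.
Qed.

Lemma mxquadE v (A : 'M[R[i]]_d) : mxquad v A =
  \sum_(p : 'I_d * 'I_d) (complex.Re (v 0 p.1 * (v 0 p.2)^* ) * complex.Re (A p.1 p.2)
    + - complex.Im (v 0 p.1 * (v 0 p.2)^* ) * complex.Im (A p.1 p.2)).
Proof.
rewrite /mxquad mxE Re_sum.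
rewrite -(pair_bigA _ (fun i j => complex.Re (v 0 i * (v 0 j)^* ) * complex.Re (A i j)
    + - complex.Im (v 0 i * (v 0 j)^* ) * complex.Im (A i j)))/=.
rewrite exchange_big/=; apply: eq_bigr => j _.
rewrite mxE mulr_suml Re_sum; apply: eq_bigr => i _.
by rewrite !mxE mulrAC ReM mulNr.
Qed.

Lemma expectation_mxquad v B : mx_integrable P B ->
  P.-integrable setT (fun w => (mxquad v (B w))%:E) /\
  (\int[P]_w (mxquad v (B w))%:E = (mxquad v (mx_expectation P B))%:E)%E.
Proof.
move=> Bi.
have term (p : 'I_d * 'I_d) := integral_linear2
  (complex.Re (v 0 p.1 * (v 0 p.2)^* )) (- complex.Im (v 0 p.1 * (v 0 p.2)^* ))
  (Bi p.1 p.2).1 (Bi p.1 p.2).2.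
under [X in P.-integrable _ X]eq_fun do rewrite mxquadE -sumEFin.
split; first by apply: integrable_sum => // p _; exact: (term p).1.
under eq_integral do rewrite mxquadE -sumEFin.
rewrite integral_sum//; last by move=> p; exact: (term p).1.
rewrite mxquadE -sumEFin; apply: eq_bigr => p _.
by rewrite (term p).2 !mxE/= unlock.
Qed.

Lemma mx_expectation_hermsym B : mx_integrable P B ->
  (forall w, B w \is hermsymmx) -> mx_expectation P B \is hermsymmx.
Proof.
move=> Bi Bh.
have BE w i j : B w i j = (B w j i)^*.
  by have := Bh w; rewrite hermsymmxE => /eqP {1}<-; rewrite !mxE.
rewrite hermsymmxE; apply/eqP/matrixP => i j; rewrite !mxE unlock/=.
apply/eqP; rewrite eq_complex/=; apply/andP; split; apply/eqP.
  by congr fine; apply: eq_integral => w _; rewrite BE; case: (B w i j).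
have [_ /(congr1 fine)/=] := integral_linear2 0 (- 1) (Bi j i).1 (Bi j i).2.
rewrite mul0r add0r mulN1r => <-; congr fine; apply: eq_integral => w _.
by rewrite mul0r add0r mulN1r (BE w i j); case: (B w j i).
Qed.

End matrix_expectation.

(** * Jensen inequality for the normalized trace of the logarithm *)

Section trace_exponential_bound.
Context {R : realType} {dT : measure_display} {T : measurableType dT}.
Variables (P : probability T R) (d : nat).

Lemma integral_gt0 (f : T -> R) : P.-integrable setT (EFin \o f) ->
  (forall w, 0 < f w) -> (0 < \int[P]_w (f w)%:E)%E.
Proof.
move=> fi f0; rewrite lt_def integral_ge0 ?andbT; last first.
  by move=> w _; rewrite lee_fin ltW.
have mf : measurable_fun setT (EFin \o f) by case/integrableP: fi.
apply/negP => /eqP int0.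
have : (\int[P]_w `|(EFin \o f) w| = 0)%E.
  by rewrite -int0; apply: eq_integral => w _; rewrite gee0_abs// lee_fin ltW.
move/(ae_eq_integral_abs P measurableT mf) => [N [mN PN0 /= sub]].
have NT : N = setT.
  apply/seteqP; split=> // w _; apply: sub => /=.
  by move=> /(_ Logic.I) [] f00; move: (f0 w); rewrite f00 ltxx.
have : P setT = 0%E by rewrite -NT; exact: PN0.
by rewrite probability_setT => /eqP; rewrite onee_eq0.
Qed.

Variable A : T -> 'M[R[i]]_d.
Hypothesis A_hermsym : forall w, A w \is hermsymmx.
Hypothesis expA_integrable : mx_integrable P (fun w => mxexp (A w)).

Let M := mx_expectation P (fun w => mxexp (A w)).

Lemma expectation_mxexp_hermsym : M \is hermsymmx.
Proof. by apply: mx_expectation_hermsym => // w; exact: mxfun_hermsym. Qed.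

Lemma mxquad_eigval j : mxquad (row j (spectralmx M)) M = eigval M j.
Proof.
by rewrite -{2}(mxfun_id expectation_mxexp_hermsym) mxquad_spectral.
Qed.

(** With [q_j] the quadratic form at the [j]-th eigenvector of [M], the
    eigenvalue [q_j M] is the expectation of [q_j (e^A)], which is pointwise at
    least [e^(q_j A)], hence positive. *)
Lemma eigval_expectation_mxexp_gt0 j : 0 < eigval M j.
Proof.
set v := row j (spectralmx M).
have [qi qE] := expectation_mxquad v expA_integrable.
rewrite -mxquad_eigval -lte_fin -qE; apply: integral_gt0 => // w.
apply: lt_le_trans (expR_mxquad_le (A_hermsym w) _); first exact: expR_gt0.
by rewrite mxquad_row1// spectral_unitarymx.
Qed.

(** With [q_j] the quadratic forms at the eigenvectors of [M] and [m_j] its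
    eigenvalues, [tr A - tr (log M)] is the sum of the [q_j A - ln m_j]; the Jensen inequality with weights [1/d] followed by
    [expR_mxquad_le] gives a bound that is linear in [e^A]. *)
Lemma expR_trace_le w : (0 < d)%N ->
  expR (d%:R^-1 * complex.Re (\tr (A w))) <=
  \sum_j expR (d%:R^-1 * complex.Re (\tr (mxlog M))) / d%:R / eigval M j *
    mxquad (row j (spectralmx M)) (mxexp (A w)).
Proof.
move=> d0; have dn0 : d%:R != 0 :> R by rewrite pnatr_eq0 -lt0n.
set L := complex.Re (\tr (mxlog M)).
pose q j := mxquad (row j (spectralmx M)) (A w).
have -> : d%:R^-1 * complex.Re (\tr (A w)) =
    d%:R^-1 * L + \sum_(j < d) d%:R^-1 * (q j - ln (eigval M j)).
  rewrite -mulr_sumr -mulrDr; congr (_ * _).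
  rewrite sumrB sum_mxquad_row ?spectral_unitarymx// /L Re_trace_mxfun.
  by rewrite addrC subrK.
rewrite expRD.
have wge0 (j : 'I_d) : 0 <= d%:R^-1 :> R by [].
have w1 : \sum_(j < d) d%:R^-1 = 1 :> R.
  by rewrite sumr_const card_ord -[_ *+ d]mulr_natl mulfV.
apply: le_trans (ler_wpM2l (expR_ge0 _) (expR_convex_sum _ wge0 w1)) _.
rewrite mulr_sumr; apply: ler_sum => j _.
rewrite -!mulrA; apply: ler_wpM2l; first exact: expR_ge0.
apply: ler_wpM2l => //; have m0 := eigval_expectation_mxexp_gt0 j.
rewrite expRD expRN lnK ?posrE// mulrC; apply: ler_wpM2l.
  by rewrite invr_ge0 ltW.
by apply: expR_mxquad_le => //; rewrite mxquad_row1// spectral_unitarymx.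
Qed.

(** The expectation of [q_j (e^A)] is [m_j], which cancels the denominator in
    [expR_trace_le], leaving [d] equal terms of weight [1/d]. *)
Lemma integral_expR_trace_le : (0 < d)%N ->
  measurable_fun setT (fun w => complex.Re (\tr (A w))) ->
  (\int[P]_w (expR (d%:R^-1 * complex.Re (\tr (A w))))%:E <=
   (expR (d%:R^-1 * complex.Re (\tr (mxlog M))))%:E)%E.
Proof.
move=> d0 mtr; have dn0 : d%:R != 0 :> R by rewrite pnatr_eq0 -lt0n.
set L := complex.Re (\tr (mxlog M)).
pose c j := expR (d%:R^-1 * L) / d%:R / eigval M j.
pose q j w := (mxquad (row j (spectralmx M)) (mxexp (A w)))%:E.
have qi j : P.-integrable setT (q j).
  by have [] := expectation_mxquad (row j (spectralmx M)) expA_integrable.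
have cqi j : P.-integrable setT (fun w => (c j)%:E * q j w)%E.
  exact: integrableZl.
apply: (@le_trans _ _ (\int[P]_w (\sum_j ((c j)%:E * q j w)))%E).
  apply: ge0_le_integral => //.
  - apply/measurable_EFinP; apply: measurableT_comp => //.
    exact: measurable_funM.
  - by apply: emeasurable_sum => j; case/integrableP: (cqi j).
  - move=> w _; under eq_bigr do rewrite -EFinM.
    by rewrite sumEFin lee_fin; exact: expR_trace_le.
rewrite integral_sum//.
rewrite (eq_bigr (fun j => (expR (d%:R^-1 * L) / d%:R)%:E)); last first.
  move=> j _; rewrite integralZl//.
  rewrite (expectation_mxquad (row j (spectralmx M)) expA_integrable).2.
  rewrite mxquad_eigval -EFinM /c mulfVK//.
  by rewrite gt_eqF// eigval_expectation_mxexp_gt0.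
by rewrite sumEFin sumr_const card_ord lee_fin -[_ *+ d]mulr_natl mulrC mulfVK.
Qed.

End trace_exponential_bound.

(** * Real functions of independent random matrices *)

(** A point of [R[i]], and thus of the matrices over it, is what turns the
    sigma-algebra [mx_measurable] into a measurable type, on which sums of
    coordinates are known to be measurable. *)
HB.instance Definition _ (R : realType) := isPointed.Build R[i] 0.

Section functions_of_independent_matrices.
Context {R : realType} {d : nat}.

Lemma mx_measurable_Re_trace_preimage (h : R -> R) (B : set R) :
  measurable_fun setT h -> measurable B ->
  mx_measurable [set M : 'M[R[i]]_d | B (h (complex.Re (\tr M)))].
Proof.
move=> mh mB; rewrite /mx_measurable; set G := (X in <<s X >>).
pose S : measurableType _ := g_sigma_algebraType G.
have mtr : measurable_fun setT (fun M : S => complex.Re (\tr (M : 'M[R[i]]_d))).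
  under eq_fun do rewrite /mxtrace Re_sum.
  apply: measurable_sum => i _ C mC; rewrite setTI.
  by apply: sub_sigma_algebra; exists i, i, C; split => //; left.
have : measurable_fun setT (fun M : S => h (complex.Re (\tr (M : 'M[R[i]]_d)))).
  exact: measurableT_comp mh mtr.
by move=> /(_ measurableT B mB); rewrite setTI.
Qed.

End functions_of_independent_matrices.

Lemma Re_traceZ (R : realType) (d : nat) (a : R) (A : 'M[R[i]]_d) :
  complex.Re (\tr (a%:C *: A)) = a * complex.Re (\tr A).
Proof. by rewrite mxtraceZ Re_scale. Qed.

Lemma Re_trace_sum (R : realType) (d : nat) (I : finType) (F : I -> 'M[R[i]]_d) :
  complex.Re (\tr (\sum_k F k)) = \sum_k complex.Re (\tr (F k)).
Proof. by rewrite [\tr _]raddf_sum/= Re_sum. Qed.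

Lemma mx_independent_Re_trace (R : realType) (dT : measure_display)
    (T : measurableType dT) (P : probability T R) (d : nat) (I : finType)
    (X : I -> T -> 'M[R[i]]_d) (h : R -> R) : measurable_fun setT h ->
  mx_independent P X -> forall B : I -> set R, (forall k, measurable (B k)) ->
  P (\bigcap_(k in [set: I])
       ((fun w => h (complex.Re (\tr (X k w)))) @^-1` B k)) =
  (\prod_k P ((fun w => h (complex.Re (\tr (X k w)))) @^-1` B k))%E.
Proof.
move=> mh Xind B mB.
have := Xind (finset.setT) (fun k => [set M | B k (h (complex.Re (\tr M)))]).
under eq_bigl do rewrite finset.in_setT.
rewrite (_ : [set` _] = setT); last by apply/seteqP; split=> k //= _; rewrite finset.in_setT.
by apply => k _; exact: mx_measurable_Re_trace_preimage mh (mB k).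
Qed.

(** * The tail bound *)

Theorem theorem2p1 (R : realType) (dT : measure_display)
    (T : measurableType dT) (P : probability T R) (d K : nat)
    (X : 'I_K -> T -> 'M[R[i]]_d) (eps : R) :
  (0 < d)%N ->
  (forall k, random_mx (X k)) ->
  (forall k w, X k w \is hermsymmx) ->
  mx_independent P X ->
  0 < eps ->
  (P [set w | (lambda_max (\sum_(k < K) X k w) <= eps)%R] <=
   ereal_inf
     [set (expR (theta * eps) *
           expR (lambda_max (\sum_(k < K)
             mxlog (mx_expectation P
               (fun w => mxexp ((- theta)%:C *: X k w))))))%:E
     | theta in [set theta : R | (0 < theta)%R /\
         forall k, mx_integrable P
           (fun w => mxexp ((- theta)%:C *: X k w))]])%E.
Proof.
move=> d0 mX Xh Xind _; apply: le_ereal_inf_tmp => _ [theta [t0 expX_int] <-].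
have dn0 : d%:R != 0 :> R by rewrite pnatr_eq0 -lt0n.
set E := [set w | _].
have sumXh w : \sum_k X k w \is hermsymmx by exact: hermsym_sum.
have mE : measurable E.
  apply: (measurable_lambda_max_le _ d0) => // i j.
  under eq_fun do rewrite summxE.
  by apply: cmeasurable_sum => k; have [] := mX k i j.
pose h (x : R) := expR (d%:R^-1 * (- theta * x)).
have mh : measurable_fun setT h.
  by apply: measurableT_comp => //; exact: measurableT_comp.
pose W k w := h (complex.Re (\tr (X k w))).
have mtr k : measurable_fun setT (fun w => complex.Re (\tr (X k w))).
  under eq_fun do rewrite /mxtrace Re_sum.
  by apply: measurable_sum => i; have [] := mX k i i.
have mW k : measurable_fun setT (W k) by exact: measurableT_comp.
pose L k := mxlog (mx_expectation P (fun w => mxexp ((- theta)%:C *: X k w))).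
have int_prod : (\int[P]_w (\prod_k W k w)%:E <=
    (\prod_k expR (d%:R^-1 * complex.Re (\tr (L k))))%:E)%E.
  apply: integral_prod_independent_le => //.
  - exact: mx_independent_Re_trace.
  - by move=> k w; exact: expR_ge0.
  move=> k; have := integral_expR_trace_le
    (fun w => hermsym_scale (- theta) (Xh k w)) (expX_int k) d0.
  under eq_fun do rewrite Re_traceZ.
  under eq_integral do rewrite Re_traceZ.
  by apply; exact: measurable_funM.
have sum_le : \sum_k d%:R^-1 * complex.Re (\tr (L k)) <= lambda_max (\sum_k L k).
  rewrite -mulr_sumr -Re_trace_sum mulrC ler_pdivrMr ?ltr0n// mulrC.
  apply: Re_trace_le_lambda_max => //; apply: hermsym_sum => k.
  exact: mxfun_hermsym.
have mprod : measurable_fun setT (fun w => (\prod_k W k w)%:E).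
  by apply/measurable_EFinP; exact: measurable_prod.
have prod0 w : (0 <= (\prod_k W k w)%:E)%E.
  by rewrite lee_fin; apply: prodr_ge0 => k _; exact: expR_ge0.
apply: (@le_trans _ _ (\int[P]_w ((expR (theta * eps))%:E * (\prod_k W k w)%:E))%E).
  rewrite -[E in P E]setIT -integral_indic//; apply: ge0_le_integral => //.
  - by apply/measurable_EFinP; exact: measurable_indic.
  - by apply: measurable_funeM.
  move=> w _; rewrite indicE; have [wE|_] := boolP (w \in E); last first.
    by rewrite mule_ge0// lee_fin expR_ge0.
  (* The exponent is [theta (eps - tr (sum_k X_k) / d)], nonnegative on [E]. *)
  rewrite -EFinM lee_fin -expR_sum -expRD -[leLHS]expR0 ler_expR.
  rewrite -mulr_sumr -mulr_sumr -Re_trace_sum mulNr mulrN subr_ge0 mulrCA.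
  apply: ler_wpM2l; first exact: ltW.
  rewrite mulrC ler_pdivrMr ?ltr0n// mulrC.
  apply: le_trans (Re_trace_le_lambda_max d0 (sumXh w)) _.
  by apply: ler_wpM2l => //; move: wE; rewrite inE.
rewrite ge0_integralZl_EFin ?expR_ge0// EFinM; apply: lee_wpmul2l.
  by rewrite lee_fin expR_ge0.
by apply: le_trans int_prod _; rewrite -expR_sum lee_fin ler_expR.
Qed.
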